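(* Let $X$ be any metric space. The following are equivalent: (1) $X$ is coarsely embeddable in Hilbert space. (2) For every $R,\epsilon>0$ there exist a (real) Hilbert space $\mathcal{H}$ and a map $\eta:X\to\mathcal{H}$, $x\mapsto\eta_x$, satisfying: (a) $\|\eta_x\|=1$ for all $x\in X$; (b) $\eta$ has $(R,\epsilon)$ variation; (c) $\lim_{S\to\infty}\sup\{|\langle\eta_x,\eta_y\rangle|:d(x,y)\ge S\}=0$. (3) For all $R,\epsilon>0$ there exists a normalised symmetric kernel $k:X\times X\to\mathbb{R}$ of positive type and $(R,\epsilon)$ variation, such that $\lim_{S\to\infty}\sup\{|k(x,y)|:d(x,y)\ge S\}=0$. (4) There exist a symmetric, normalised negative type kernel $k:X\times X\to\mathbb{R}$ and non-decreasing maps $\rho_1,\rho_2:\mathbb{R}^+\to\mathbb{R}^+$ such that $\rho_1(t)\to+\infty$ as $t\to+\infty$ and $$\rho_1(d(x,y))\le k(x,y)\le\rho_2(d(x,y))$$ for all $x,y\in X$.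
   Context: A map $f:X\to Y$ of metric spaces is bornologous if for all $R>0$ there exists $S>0$ such that $d(x,x')<R$ implies $d(f(x),f(x'))<S$; it is effectively proper if for all $R>0$ there exists $S>0$ such that $f^{-1}(B(f(x),R))\subseteq B(x,S)$ for all $x\in X$. A coarse embedding is an effectively proper, bornologous map. $X$ is coarsely embeddable in Hilbert space if there is a coarse embedding of $X$ into some Hilbert space. A map $x\mapsto\eta_x$ from $X$ to a Banach space has $(R,\epsilon)$ variation if $d(x,y)\le R$ implies $\|\eta_x-\eta_y\|<\epsilon$. A kernel on $X$ is a map $k:X\times X\to\mathbb{R}$; it is symmetric if $k(x,y)=k(y,x)$, and has $(R,\epsilon)$ variation if $d(x,y)\le R$ implies $|k(x,y)-1|<\epsilon$. It is of positive type if $\sum_{i,j=1}^n\lambda_i\lambda_jk(x_i,x_j)\ge0$ for all finite sequences $x_1,\dots,x_n\in X$ and $\lambda_1,\dots,\lambda_n\in\mathbb{R}$; it is of negative type if $\sum_{i,j=1}^n\lambda_i\lambda_jk(x_i,x_j)\le0$ for all finite sequences $x_1,\dots,x_n\in X$ and $\lambda_1,\dots,\lambda_n\in\mathbb{R}$ with $\sum_{i=1}^n\lambda_i=0$. A positive type kernel is normalised if $k(x,x)=1$ for all $x$; a negative type kernel is normalised if $k(x,x)=0$ for all $x$. *)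

(* Defs.v *)
From HB Require Import structures.
From mathcomp Require Import all_boot all_order all_algebra.
From mathcomp Require Import all_classical all_reals all_analysis.
From mathcomp Require Import sesquilinear.

Set Implicit Arguments.
Unset Strict Implicit.
Unset Printing Implicit Defensive.

Import Order.TTheory GRing.Theory Num.Theory.
Import numFieldNormedType.Exports.

Local Open Scope classical_set_scope.
Local Open Scope ring_scope.

(* A real Hilbert space: a complete normed space whose norm comes from an inner
   product. The distance function [mdist] of the metric structure is forced to
   be the one of the norm, see [mdist_hilbertE]. *)
HB.mixin Record NormedModule_hasInner (R : realType) H
    & NormedModule R H := {
  inner : {dot H for (@idfun R)} ;
  inner_norm : forall x : H, inner x x = `|x| ^+ 2
}.

#[short(type="hilbertType")]
HB.structure Definition Hilbert (R : realType) :=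
  {H of CompleteNormedModule R H & Metric R H & NormedModule_hasInner R H}.

Lemma mdist_hilbertE (R : realType) (H : hilbertType R) (x y : H) :
  mdist x y = `|x - y|.
Proof.
have ballE d : (mdist x y < d) = (`|x - y| < d).
  have E : [set z : H | mdist x z < d] = [set z : H | `|x - z| < d].
    by rewrite -ballEmdist -ball_normE.
  apply/idP/idP => h.
    have : [set z : H | mdist x z < d] y by [].
    by rewrite E.
  have : [set z : H | `|x - z| < d] y by [].
  by rewrite -E.
by apply/eqP; rewrite eq_le !leNgt ballE ltxx -ballE ltxx.
Qed.

Section CoarseMaps.
Context {R : realType} {X Y : metricType R}.

Definition bornologous (f : X -> Y) : Prop :=
  forall r : R, 0 < r -> exists2 s : R, 0 < s &
    forall x x' : X, mdist x x' < r -> mdist (f x) (f x') < s.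

Definition effectively_proper (f : X -> Y) : Prop :=
  forall r : R, 0 < r -> exists2 s : R, 0 < s &
    forall x : X, f @^-1` (ball (f x) r) `<=` ball x s.

Definition coarse_embedding (f : X -> Y) : Prop :=
  effectively_proper f /\ bornologous f.

End CoarseMaps.

Definition coarsely_embeddable_in_Hilbert (R : realType) (X : metricType R) :
    Prop :=
  exists (H : hilbertType R) (f : X -> H), coarse_embedding f.

Definition has_variation (R : realType) (X : metricType R)
    (V : completeNormedModType R) (r e : R) (eta : X -> V) : Prop :=
  forall x y : X, mdist x y <= r -> `|eta x - eta y| < e.

Section Kernels.
Context {R : realType} {X : metricType R}.
Implicit Type k : X -> X -> R.

Definition symmetric_kernel k : Prop := forall x y, k x y = k y x.

Definition kernel_has_variation (r e : R) k : Prop :=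
  forall x y, mdist x y <= r -> `|k x y - 1| < e.

Definition positive_type k : Prop :=
  forall (n : nat) (x : 'I_n -> X) (lambda : 'I_n -> R),
    0 <= \sum_(i < n) \sum_(j < n) lambda i * lambda j * k (x i) (x j).

Definition negative_type k : Prop :=
  forall (n : nat) (x : 'I_n -> X) (lambda : 'I_n -> R),
    \sum_(i < n) lambda i = 0 ->
    \sum_(i < n) \sum_(j < n) lambda i * lambda j * k (x i) (x j) <= 0.

Definition normalised_positive_type k : Prop :=
  positive_type k /\ (forall x, k x x = 1).

Definition normalised_negative_type k : Prop :=
  negative_type k /\ (forall x, k x x = 0).

(* sup {|k x y| : d(x, y) >= s}, taken in [0, +oo]: adjoining 0 makes the
   supremum of the empty set 0, as it should be when X is bounded. *)
Definition tail_sup k (s : R) : \bar R :=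
  ereal_sup (0%E |` [set z | exists x y, s <= mdist x y /\ z = `|k x y|%:E]).

Definition vanishes_at_infinity k : Prop :=
  tail_sup k s @[s --> +oo] --> 0%E.

End Kernels.

(* [rho] restricts to a non-decreasing map [0, +oo[ -> [0, +oo[; its values at
   negative arguments are irrelevant. *)
Definition nondecreasing_nonneg_map (R : realType) (rho : R -> R) : Prop :=
  {in Num.nneg, forall t, 0 <= rho t} /\
  {in Num.nneg &, {homo rho : s t / s <= t}}.

(* Main.v *)
(* (1) => (2): exp(- t |f x - f y|^2) is a positive type kernel, because it is
   a positive multiple g(x) g(y) of exp(2 t <f x, f y>) and products (Schur),
   sums and limits of positive type kernels are of positive type; it is thus the
   Gram kernel of unit vectors, and a small t gives the (R, e) variation.
   (2) => (3): take k = <eta, eta>.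
   (3) => (4): take k = sum_n (1 - k_n) where k_n has (n + 1, 2^-n) variation;
   the terms with n >= d(x, y) have a bounded sum, while every n with
   |k_n(x, y)| <= 1/2 contributes at least 1/2.
   (4) => (1): (k(x, x0) + k(y, x0) - k(x, y)) / 2 is a positive type kernel,
   and a map f with that Gram kernel satisfies |f x - f y|^2 = k(x, y).
   A positive type kernel is the Gram kernel of a map into a Hilbert space
   (Moore-Aronszajn): that space is realised as the bounded linear functionals
   on the formal combinations of points, with the dual norm, whose inner product
   is recovered from the parallelogram law (Jordan-von Neumann). *)
Require Import Defs.
From HB Require Import structures.
From mathcomp Require Import all_boot all_order all_algebra.
From mathcomp Require Import all_classical all_reals all_analysis.
From mathcomp Require Import sesquilinear ring lra.

Set Implicit Arguments.
Unset Strict Implicit.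
Unset Printing Implicit Defensive.

Import Order.TTheory GRing.Theory Num.Theory.
Import numFieldNormedType.Exports.

Local Open Scope classical_set_scope.
Local Open Scope ring_scope.

(** * The Jordan-von Neumann theorem *)

Section AdditiveBounded.
Context {R : realType} (phi : R -> R).
Hypotheses (phiD : {morph phi : s t / s + t}) (phi1 : phi 1 = 0).

Lemma additive_natmul (t : R) n : phi (t *+ n) = phi t *+ n.
Proof.
have phi0 : phi 0 = 0 by apply: (addrI (phi 0)); rewrite -phiD !addr0.
by elim: n => [|n IH]; rewrite ?mulr0n ?phi0// !mulrS phiD IH.
Qed.

(** A nonzero value [phi t] would make [phi (t *+ n)] grow linearly in [n]. But [phi] vanishes on
    integers, so removing the integer part of [t *+ n] brings the argument into [0, 1], where [C]
    bounds [phi]. *)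
Lemma additive_bounded_eq0 (C : R) :
  (forall t, 0 <= t <= 1 -> `|phi t| <= C) -> forall t, phi t = 0.
Proof.
move=> phiC.
have phi_ge0 t : 0 <= t -> phi t = 0.
  move=> t0; apply/eqP; apply: contraT => phit0.
  have {}phit0 : 0 < `|phi t| by rewrite normr_gt0.
  pose n := Num.truncn (C / `|phi t|).
  have : `|phi (t *+ n.+1)| <= C.
    have tn0 : 0 <= t *+ n.+1 by rewrite mulrn_wge0.
    have /andP[m1 m2] := truncn_itv tn0.
    set m := Num.truncn _ in m1 m2.
    rewrite -[t *+ _](subrK m%:R) phiD additive_natmul phi1 mul0rn addr0.
    by apply: phiC; rewrite subr_ge0 m1/= lerBlDl natr1 ltW.
  rewrite additive_natmul normrMn -mulr_natr mulrC -ler_pdivlMr// leNgt.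
  by rewrite truncnS_gt.
have phiN t : phi (- t) = - phi t.
  have := phiD t (- t); rewrite subrr => h.
  have phi0 : phi 0 = 0 by apply: phi_ge0.
  by apply/eqP; rewrite -addr_eq0 addrC -h phi0.
move=> t; have [/phi_ge0//|/ltW t0] := leP 0 t.
by apply: oppr_inj; rewrite -phiN oppr0 phi_ge0// oppr_ge0.
Qed.

End AdditiveBounded.

Section JordanVonNeumann.
Context {R : realType} {V : lmodType R} (N : V -> R).
Hypotheses (N_ge0 : forall u, 0 <= N u)
  (NZ : forall a u, N (a *: u) = a ^+ 2 * N u)
  (parallelogram : forall u v, N (u + v) + N (u - v) = 2 * N u + 2 * N v).

Definition polar (u v : V) := (N (u + v) - N (u - v)) / 4.

Lemma sqnormN u : N (- u) = N u.
Proof. by rewrite -scaleN1r NZ sqrrN expr1n mul1r. Qed.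

Lemma polarC u v : polar u v = polar v u.
Proof. by rewrite /polar (addrC u v) -(sqnormN (u - v)) opprB. Qed.

Lemma polarNr u v : polar u (- v) = - polar u v.
Proof. by rewrite /polar opprK; lra. Qed.

Lemma polarvv u : polar u u = N u.
Proof.
rewrite /polar subrr -mulr2n -scaler_nat NZ.
have := NZ 0 0; rewrite scaler0 expr0n/= mul0r => ->; lra.
Qed.

Lemma polarDr u v w : polar u (v + w) = polar u v + polar u w.
Proof.
(* Difference of the parallelogram laws at [(u + x, y)] and [(u - x, y)]. Adding [E v w] and [E w v]
   then cancels the terms in [v - w] by oddness. *)
have E x y : polar u (x + y) + polar u (x - y) = 2 * polar u x.
  have := parallelogram (u + x) y; have := parallelogram (u - x) y.
  rewrite /polar !opprD opprK !addrA; lra.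
have := E v w; have := E w v; rewrite -(opprB v w) polarNr (addrC w v); lra.
Qed.

Lemma polar_bound u v : `|polar u v| <= (N u + N v) / 2.
Proof.
have := parallelogram u v; have := N_ge0 (u + v); have := N_ge0 (u - v).
rewrite /polar => ? ? ?; rewrite ler_norml; apply/andP; split; lra.
Qed.

(** The defect from homogeneity is additive in the scalar, vanishes at 1 and is bounded on [0, 1] by
    [polar_bound]; hence it is zero. *)
Lemma polarZr a u v : polar u (a *: v) = a * polar u v.
Proof.
pose phi a := polar u (a *: v) - a * polar u v.
suff /(_ a) : forall t, phi t = 0 by move/eqP; rewrite subr_eq0 => /eqP.
apply: (@additive_bounded_eq0 _ _ _ _ ((N u + N v) / 2 + `|polar u v|)).
- by move=> s t; rewrite /phi scalerDl polarDr; lra.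
- by rewrite /phi scale1r mul1r subrr.
move=> t /andP[t0 t1]; apply: le_trans (ler_normB _ _) _; apply: lerD.
  apply: le_trans (polar_bound _ _) _.
  rewrite ler_pM2r ?invr_gt0// lerD2l NZ ler_piMl// expr_le1//.
by rewrite normrM ler_piMl// ger0_norm.
Qed.

Lemma polar_bilinear : bilinear_for *%R (idfun \; *%R) polar.
Proof.
split=> w a u v /=.
  by rewrite polarC polarDr polarZr !(polarC w).
by rewrite polarDr polarZr.
Qed.

Lemma polar_sqrD u v : N (u + v) = N u + 2 * polar u v + N v.
Proof.
by rewrite -!polarvv polarDr !(polarC (u + v)) !polarDr (polarC v u); ring.
Qed.

Lemma polar_CauchySchwarz u v : polar u v ^+ 2 <= N u * N v.
Proof.
have E a b : 0 <= a ^+ 2 * N u + 2 * a * b * polar u v + b ^+ 2 * N v.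
  have := N_ge0 (a *: u + b *: v).
  by rewrite polar_sqrD !NZ polarZr polarC polarZr polarC !mulrA
    -(mulrA 2) (mulrC b) mulrA.
(* If [N v = 0], the chosen coefficients turn [E] into [- (N u + 2) * polar u v ^+ 2 >= 0].
   Otherwise [(N v, - polar u v)] turns it into [N v] times the claim. *)
have := N_ge0 v; rewrite le_eqVlt => /predU1P[v0|v0].
  have := E (polar u v) (- (1 + N u)); rewrite -v0; have := N_ge0 u.
  have := sqr_ge0 (polar u v); nra.
have := E (N v) (- polar u v); nra.
Qed.

Lemma sqrt_sqnormD u v :
  Num.sqrt (N (u + v)) <= Num.sqrt (N u) + Num.sqrt (N v).
Proof.
rewrite -(ler_pXn2r (_ : 0 < 2)%N)// ?nnegrE ?addr_ge0 ?sqrtr_ge0//.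
rewrite sqrrD !sqr_sqrtr// polar_sqrD lerD2r lerD2l.
rewrite -[leRHS]mulr_natl ler_pM2l//.
apply: le_trans (ler_norm _) _; rewrite -sqrtr_sqr -sqrtrM//.
exact: ler_wsqrtr (polar_CauchySchwarz _ _).
Qed.

End JordanVonNeumann.

(** * The Hilbert space of a positive semidefinite kernel *)

Section FormalCombinations.
Context {R : realType} {T : Type}.
Implicit Types (k : T -> T -> R) (f : T -> R) (u v w : seq (R * T)) (a : R).

(** A list of weighted points encodes a formal combination. Points may repeat, so concatenation
    serves as addition and no normal form is kept. *)
Definition lin f v : R := \sum_(p <- v) p.1 * f p.2.

Definition gram k u v : R := \sum_(p <- u) p.1 * lin (k p.2) v.

Definition comb_scale a v : seq (R * T) := [seq (a * p.1, p.2) | p <- v].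

Definition pos_semidef k : Prop := forall v, 0 <= gram k v v.

Lemma lin_cat f u v : lin f (u ++ v) = lin f u + lin f v.
Proof. exact: big_cat. Qed.

Lemma lin_scale f a v : lin f (comb_scale a v) = a * lin f v.
Proof.
by rewrite /lin big_map mulr_sumr; apply: eq_bigr => p _; rewrite mulrA.
Qed.

Lemma lin_delta f x : lin f [:: (1, x)] = f x.
Proof. by rewrite /lin big_seq1 mul1r. Qed.

Lemma linD f g v : lin (f + g) v = lin f v + lin g v.
Proof.
by rewrite /lin -big_split/=; apply: eq_bigr => p _; rewrite -mulrDr.
Qed.

Lemma linZ a f v : lin (a *: f) v = a * lin f v.
Proof.
by rewrite /lin mulr_sumr; apply: eq_bigr => p _; rewrite mulrCA.
Qed.

Lemma linB f g v : lin (f - g) v = lin f v - lin g v.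
Proof. by rewrite -[- g]scaleN1r linD linZ mulN1r. Qed.

Lemma gramEr k u v : gram k u v = lin (fun y => lin (k^~ y) u) v.
Proof.
rewrite /gram /lin.
under eq_bigr do rewrite mulr_sumr.
rewrite exchange_big/=; apply: eq_bigr => p _.
by rewrite mulr_sumr; apply: eq_bigr => q _; rewrite mulrCA.
Qed.

Lemma gram_catl k u v w : gram k (u ++ v) w = gram k u w + gram k v w.
Proof. exact: big_cat. Qed.

Lemma gram_catr k u v w : gram k w (u ++ v) = gram k w u + gram k w v.
Proof. by rewrite !gramEr lin_cat. Qed.

Lemma gram_scalel k a u v : gram k (comb_scale a u) v = a * gram k u v.
Proof.
by rewrite /gram big_map mulr_sumr; apply: eq_bigr => p _; rewrite mulrA.
Qed.

Lemma gram_scaler k a u v : gram k u (comb_scale a v) = a * gram k u v.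
Proof. by rewrite !gramEr lin_scale. Qed.

Lemma gram_delta k x y : gram k [:: (1, x)] [:: (1, y)] = k x y.
Proof. by rewrite /gram big_seq1 mul1r lin_delta. Qed.

Lemma gramC k u v : (forall x y, k x y = k y x) -> gram k u v = gram k v u.
Proof.
move=> kC; rewrite gramEr /gram /lin; apply: eq_bigr => p _; congr (_ * _).
by apply: eq_bigr => q _; rewrite kC.
Qed.

End FormalCombinations.

Definition simpg := (@gram_catl, @gram_catr, @gram_scalel, @gram_scaler).

Record psd_kernel (R : realType) (T : Type) := PsdKernel {
  psd_fun :> T -> T -> R ;
  psd_sym : forall x y, psd_fun x y = psd_fun y x ;
  psd_pos : pos_semidef psd_fun }.

(** * Functionals of finite dual norm *)

Section BoundedFunctionals.
Context {R : realType} {T : Type} (K : psd_kernel R T).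
Implicit Types (f g : T -> R) (u v : seq (R * T)).

(* The squared dual norm is the supremum over v of [2 f(v) - |v|^2]; unlike the
   supremum of [f(v) / |v|], it makes sense for degenerate K and inherits the
   parallelogram law by a change of variables. *)
Definition excess f v := 2 * lin f v - gram K v v.

Definition bounded_functional f := exists M, forall v, excess f v <= M.

Lemma excessZ a f v : a != 0 ->
  excess (a *: f) (comb_scale a v) = a ^+ 2 * excess f v.
Proof. by move=> a0; rewrite /excess linZ lin_scale !simpg; ring. Qed.

(** The cross terms in [u] and [v] cancel between the two summands, in the linear part as well as in
    the quadratic one. *)
Lemma excessD f g u v :
  excess (f + g) (u ++ v) + excess (f - g) (u ++ comb_scale (-1) v) =
  2 * excess f u + 2 * excess g v.
Proof.
rewrite /excess -[- g]scaleN1r !linD !linZ !lin_cat !lin_scale !simpg.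
ring.
Qed.

Definition sqnorm f := sup (range (excess f)).

Lemma excess0 v : excess 0 v <= 0.
Proof.
rewrite /excess (_ : lin 0 v = 0); last first.
  by rewrite /lin big1// => p _; rewrite mulr0.
by rewrite mulr0 sub0r oppr_le0 psd_pos.
Qed.

Lemma excess_nil f : excess f [::] = 0.
Proof. by rewrite /excess /gram /lin !big_nil mulr0 subr0. Qed.

Lemma excess_le_sqnorm f v : bounded_functional f -> excess f v <= sqnorm f.
Proof.
case=> M fM; apply: ub_le_sup; last by exists v.
by exists M => _ [w _ <-].
Qed.

Lemma sqnorm_le f M : (forall v, excess f v <= M) -> sqnorm f <= M.
Proof.
move=> fM; apply: ge_sup; first by exists (excess f [::]), [::].
by move=> _ [w _ <-].
Qed.

Lemma sqnorm_ge0 f : bounded_functional f -> 0 <= sqnorm f.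
Proof. by move=> /(@excess_le_sqnorm _ [::]); rewrite excess_nil. Qed.

Lemma excessZ_le a f M : (forall v, excess f v <= M) ->
  forall v, excess (a *: f) v <= a ^+ 2 * M.
Proof.
move=> fM v; have [->|a0] := eqVneq a 0.
  by rewrite scale0r expr0n/= mul0r excess0.
have := excessZ f (comb_scale a^-1 v) a0.
have -> : comb_scale a (comb_scale a^-1 v) = v.
  rewrite /comb_scale -map_comp -[RHS]map_id; apply: eq_map => -[c x] /=.
  by rewrite mulVKf.
by move=> ->; rewrite ler_wpM2l// sqr_ge0.
Qed.

Lemma bounded_functionalZ a f :
  bounded_functional f -> bounded_functional (a *: f).
Proof. by move=> [M fM]; exists (a ^+ 2 * M); apply: excessZ_le. Qed.

Lemma excessD_le f g M M' :
  (forall v, excess f v <= M) -> (forall v, excess g v <= M') ->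
  forall v, excess (f + g) v <= 2 * M + 2 * M'.
Proof.
move=> fM gM v.
(* Each functional is tested on half of [v], whose squared norm is a quarter of that of [v]; the two
   doubled halves restore it. *)
have -> : excess (f + g) v = 2 * excess f (comb_scale 2^-1 v)
    + 2 * excess g (comb_scale 2^-1 v).
  by rewrite /excess linD !lin_scale !simpg; field.
by rewrite lerD// ler_wpM2l.
Qed.

Lemma bounded_functionalD f g :
  bounded_functional f -> bounded_functional g -> bounded_functional (f + g).
Proof.
by move=> [M fM] [M' gM]; exists (2 * M + 2 * M'); apply: excessD_le.
Qed.

Lemma bounded_functionalB f g :
  bounded_functional f -> bounded_functional g -> bounded_functional (f - g).
Proof.
move=> fb gb; rewrite -[- g]scaleN1r.
exact: bounded_functionalD (bounded_functionalZ _ _).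
Qed.

Lemma bounded_functional0 : bounded_functional 0.
Proof. by exists 0; apply: excess0. Qed.

Lemma sqnormZ a f : bounded_functional f -> sqnorm (a *: f) = a ^+ 2 * sqnorm f.
Proof.
have le b g : bounded_functional g -> sqnorm (b *: g) <= b ^+ 2 * sqnorm g.
  by move=> gb; apply/sqnorm_le/excessZ_le => v; apply: excess_le_sqnorm.
move=> fb; apply/eqP; rewrite eq_le le//=; have [->|a0] := eqVneq a 0.
  by rewrite expr0n/= mul0r scale0r sqnorm_ge0//; apply: bounded_functional0.
(* The reverse inequality is the direct one for the scalar [a^-1] and the functional [a *: f]. *)
have := le a^-1 _ (bounded_functionalZ a fb).
rewrite scalerA mulVf// scale1r exprVn -ler_pdivrMl ?invr_gt0 ?invrK//.
by rewrite exprn_even_gt0//= invr_eq0.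
Qed.

(** Taking suprema over [u] and [v] independently in [excessD] gives one inequality. Applied to
    [f + g] and [f - g], whose sum and difference are [2 f] and [2 g], it gives the other. *)
Lemma sqnorm_parallelogram f g :
  bounded_functional f -> bounded_functional g ->
  sqnorm (f + g) + sqnorm (f - g) = 2 * sqnorm f + 2 * sqnorm g.
Proof.
have le h h' : bounded_functional h -> bounded_functional h' ->
    2 * sqnorm h + 2 * sqnorm h' <= sqnorm (h + h') + sqnorm (h - h').
  move=> hb h'b.
  have ED u v : 2 * excess h u + 2 * excess h' v
      <= sqnorm (h + h') + sqnorm (h - h').
    rewrite -excessD lerD// excess_le_sqnorm//.
      exact: bounded_functionalD.
    exact: bounded_functionalB.
  rewrite -lerBrDr -ler_pdivlMl//; apply: sqnorm_le => u.
  rewrite ler_pdivlMl// lerBrDl -lerBrDr -ler_pdivlMl//; apply: sqnorm_le => v.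
  by rewrite ler_pdivlMl// lerBrDr addrC.
move=> fb gb; apply/eqP; rewrite eq_le le// andbT.
have := le _ _ (bounded_functionalD fb gb) (bounded_functionalB fb gb).
rewrite addrACA subrr addr0 opprB [g - f]addrC addrACA subrr add0r.
rewrite -(mulr2n f) -(mulr2n g) -(scaler_nat _ f) -(scaler_nat _ g).
by rewrite !sqnormZ//; lra.
Qed.

(** Cauchy-Schwarz for the duality: bound the excess on the multiples [a v] and optimise over
    [a]. *)
Lemma lin_sqnorm_bound f v :
  bounded_functional f -> lin f v ^+ 2 <= sqnorm f * gram K v v.
Proof.
move=> fb.
have E a : 2 * a * lin f v - a ^+ 2 * gram K v v <= sqnorm f.
  have := excess_le_sqnorm (comb_scale a v) fb.
  by rewrite /excess lin_scale !simpg !mulrA.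
have := psd_pos K v; rewrite le_eqVlt => /predU1P[q0|q0].
  (* On a null vector the bound is linear in [a]; this [a] would give [sqnorm f + 1 <= sqnorm f] if
     [lin f v] were nonzero. *)
  have := E ((sqnorm f + 1) / 2 / lin f v); rewrite -q0 mulr0 subr0 mulr0.
  have [->|l0] := eqVneq (lin f v) 0; first by rewrite expr0n.
  have -> : 2 * ((sqnorm f + 1) / 2 / lin f v) * lin f v = sqnorm f + 1.
    by field.
  by rewrite gerDl ler10.
have := E (lin f v / gram K v v).
have -> : 2 * (lin f v / gram K v v) * lin f v
  - (lin f v / gram K v v) ^+ 2 * gram K v v = lin f v ^+ 2 / gram K v v.
  by field; rewrite gt_eqF.
by rewrite ler_pdivrMr.
Qed.

Lemma sqnorm_eq0 f : bounded_functional f -> sqnorm f = 0 -> f = 0.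
Proof.
move=> fb f0; apply/funext => x; have := lin_sqnorm_bound [:: (1, x)] fb.
by rewrite f0 mul0r lin_delta real_exprn_even_le0 ?num_real//= => /eqP.
Qed.

End BoundedFunctionals.

Section KernelSections.
Context {R : realType} {T : Type} (K : psd_kernel R T).
Implicit Types (u v : seq (R * T)).

(** The Riesz embedding: pairing with [u] under the form [gram K], recorded by its values on single
    points. *)
Definition ksection u : T -> R := fun y => lin (K^~ y) u.

Lemma lin_ksection u v : lin (ksection u) v = gram K u v.
Proof. by rewrite gramEr. Qed.

(** This is the expansion of [|u - v|^2 >= 0]; equality at [v = u] makes the embedding isometric. *)
Lemma excess_ksection u v : excess K (ksection u) v <= gram K u u.
Proof.
have := psd_pos K (u ++ comb_scale (-1) v).
rewrite /excess lin_ksection !simpg (gramC v u (psd_sym K)); lra.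
Qed.

Lemma ksection_bounded u : bounded_functional K (ksection u).
Proof. by exists (gram K u u); apply: excess_ksection. Qed.

Lemma sqnorm_ksection u : sqnorm K (ksection u) = gram K u u.
Proof.
apply/eqP; rewrite eq_le sqnorm_le/=; last exact: excess_ksection.
have := excess_le_sqnorm u (ksection_bounded u); apply: le_trans.
rewrite /excess lin_ksection; lra.
Qed.

End KernelSections.

Definition rkhs_pred (R : realType) (T : Type) (K : psd_kernel R T) :
  {pred T -> R} := fun f => `[< bounded_functional K f >].

(* The dual of the space of formal combinations, hence complete for free: this
   replaces the completion of their quotient by the null vectors. *)
Definition rkhs (R : realType) (T : Type) (K : psd_kernel R T) :=
  {f : T -> R | f \in rkhs_pred K}.

(** * The Hilbert space structure on bounded functionals *)

Section Rkhs.
Context {R : realType} {T : Type} (K : psd_kernel R T).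

Lemma rkhs_submod_closed : submod_closed (rkhs_pred K).
Proof.
split; first exact/asboolP/bounded_functional0.
move=> a f g /asboolP fb /asboolP gb.
by apply/asboolP/bounded_functionalD => //; apply: bounded_functionalZ.
Qed.

HB.instance Definition _ :=
  GRing.isSubmodClosed.Build R (T -> R) (rkhs_pred K) rkhs_submod_closed.

HB.instance Definition _ := SubType.copy (rkhs K) {f | f \in rkhs_pred K}.
HB.instance Definition _ := [Choice of rkhs K by <:].
HB.instance Definition _ := [SubChoice_isSubLmodule of rkhs K by <:].

Let nrm2 (f : rkhs K) := sqnorm K (val f).

Lemma rkhs_bounded (f : rkhs K) : bounded_functional K (val f).
Proof. by case: f => f /= /asboolP. Qed.
#[local] Hint Resolve rkhs_bounded : core.

Lemma nrm2_ge0 f : 0 <= nrm2 f. Proof. exact: sqnorm_ge0. Qed.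

Lemma nrm2Z a f : nrm2 (a *: f) = a ^+ 2 * nrm2 f.
Proof. exact: sqnormZ. Qed.

Lemma nrm2_parallelogram f g :
  nrm2 (f + g) + nrm2 (f - g) = 2 * nrm2 f + 2 * nrm2 g.
Proof. exact: sqnorm_parallelogram. Qed.

Lemma nrm2_eq0 f : nrm2 f = 0 -> f = 0.
Proof. by move=> f0; apply/val_inj/(sqnorm_eq0 _ f0). Qed.

Definition rkhs_norm (f : rkhs K) : R := Num.sqrt (nrm2 f).

Lemma rkhs_normD f g : rkhs_norm (f + g) <= rkhs_norm f + rkhs_norm g.
Proof.
exact: sqrt_sqnormD nrm2_ge0 nrm2Z nrm2_parallelogram _ _.
Qed.

Lemma rkhs_normZ a f : rkhs_norm (a *: f) = `|a| * rkhs_norm f.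
Proof. by rewrite /rkhs_norm nrm2Z sqrtrM ?sqr_ge0// sqrtr_sqr. Qed.

Lemma rkhs_norm0_eq0 f : rkhs_norm f = 0 -> f = 0.
Proof.
move=> /eqP; rewrite sqrtr_eq0 => f0; apply: nrm2_eq0.
by apply/eqP; rewrite eq_le f0 nrm2_ge0.
Qed.

HB.instance Definition _ := Lmodule_isNormed.Build R (rkhs K)
  rkhs_normD rkhs_normZ rkhs_norm0_eq0.

Lemma rkhs_normE (f : rkhs K) : `|f| ^+ 2 = sqnorm K (val f).
Proof. by rewrite sqr_sqrtr// nrm2_ge0. Qed.

Let rkhs_dist (f g : rkhs K) : R := `|f - g|.

Let rkhs_dist_ge0 f g : 0 <= rkhs_dist f g. Proof. exact: normr_ge0. Qed.

Let rkhs_dist_positivity f g : rkhs_dist f g = 0 -> f = g.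
Proof. by move/normr0_eq0/subr0_eq. Qed.

Let ballE_rkhs_dist f d : ball f d = [set g | rkhs_dist f g < d].
Proof. by rewrite -ball_normE. Qed.

HB.instance Definition _ := PseudoMetric_isMetric.Build R (rkhs K)
  rkhs_dist_ge0 rkhs_dist_positivity ballE_rkhs_dist.

Definition rkhs_inner : rkhs K -> rkhs K -> R := polar nrm2.

Let rkhs_inner_bilinear : bilinear_for *%R (idfun \; *%R) rkhs_inner.
Proof. exact: polar_bilinear nrm2_ge0 nrm2Z nrm2_parallelogram. Qed.

HB.instance Definition _ := bilinear_isBilinear.Build R (rkhs K) (rkhs K) R
  *%R (idfun \; *%R) rkhs_inner rkhs_inner_bilinear.

Let rkhs_inner_hermitian f g :
  rkhs_inner f g = (-1) ^+ false * idfun (rkhs_inner g f).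
Proof. by rewrite expr0 mul1r /rkhs_inner (polarC nrm2Z). Qed.

HB.instance Definition _ := isHermitianSesquilinear.Build R (rkhs K) false idfun
  rkhs_inner rkhs_inner_hermitian.

Let rkhs_inner_gt0 f : f != 0 -> 0 < rkhs_inner f f.
Proof.
move=> f0; rewrite /rkhs_inner (polarvv nrm2Z) lt_neqAle nrm2_ge0 andbT eq_sym.
by apply: contraNN f0 => /eqP/nrm2_eq0 ->.
Qed.

HB.instance Definition _ := isDotProduct.Build R (rkhs K) rkhs_inner
  rkhs_inner_gt0.

Let rkhs_inner_norm f : rkhs_inner f f = `|f| ^+ 2.
Proof. by rewrite /rkhs_inner (polarvv nrm2Z) rkhs_normE. Qed.

Lemma lin_rkhs_bound (f : rkhs K) v :
  `|lin (val f) v| <= `|f| * Num.sqrt (gram K v v).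
Proof.
rewrite -sqrtr_sqr /Num.norm/= -sqrtrM ?nrm2_ge0// ler_wsqrtr//.
exact: (lin_sqnorm_bound v (rkhs_bounded f)).
Qed.

(** Evaluations are Lipschitz, so [F] has a pointwise limit [g]. The bounds on the excess are closed
    conditions, so they pass to [g], making it bounded and a limit in norm. *)
Lemma rkhs_complete (F : set_system (rkhs K)) :
  ProperFilter F -> cauchy F -> cvg F.
Proof.
move=> FF /cauchyP Fc.
pose g x : R := lim ((fun f : rkhs K => val f x) @ F).
have linF v : (fun f : rkhs K => lin (val f) v) @ F --> lin g v.
  apply: cvg_big => [|[c x] _ /=]; first exact: add_continuous.
  apply: cvgMl_tmp.
  apply/cauchy_cvgP/cauchy_exP => e e0.
  (* The Lipschitz constant of evaluation at [x], increased by 1 so that it can be divided by. *)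
  pose C := Num.sqrt (K x x) + 1.
  have C0 : 0 < C by rewrite ltr_wpDl// sqrtr_ge0.
  have [h Fh] := Fc (e / C) (divr_gt0 e0 C0).
  exists (val h x); rewrite nbhs_simpl/=; apply: filterS Fh => f.
  rewrite -ball_normE -ball_normE/= ltr_pdivlMr// => hf.
  apply: le_lt_trans hf; have := lin_rkhs_bound (h - f) [:: (1, x)].
  rewrite lin_delta gram_delta => /le_trans; apply.
  by rewrite ler_wpM2l// lerDl.
have gF e : 0 < e -> exists h : rkhs K, F (ball h e) /\
    forall v, excess K (g - val h) v <= e ^+ 2.
  move=> e0; have [h Fh] := Fc e e0; exists h; split=> // v.
  rewrite /excess lerBlDr.
  have cv : (fun f : rkhs K => 2 * lin (val f - val h) v) @ F
     --> 2 * lin (g - val h) v.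
    rewrite linB; under eq_fun do rewrite linB.
    by apply: cvgMl_tmp; apply: cvgB => //; apply: cvg_cst.
  apply: (closed_cvg (fun x : R => x <= _)) cv; first exact: closed_le.
  apply: filterS Fh => f; rewrite -ball_normE/= distrC => /ltW hf.
  rewrite -lerBlDr; have := excess_le_sqnorm v (rkhs_bounded (f - h)).
  move=> /le_trans; apply; rewrite -rkhs_normE ler_sqr ?nnegrE//.
  exact: ltW.
have gb : bounded_functional K g.
  have [h [_ hg]] := gF 1 ltr01.
  rewrite -(subrK (val h) g); apply: bounded_functionalD => //.
  by exists (1 ^+ 2).
have gP : g \in rkhs_pred K by apply/asboolP.
apply/cvg_ex; exists (exist _ g gP : rkhs K); apply/cvg_ballP => e e0.
have e30 : 0 < e / 3 by rewrite divr_gt0.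
have [h [Fh hg]] := gF _ e30; apply: filterS Fh => f hf.
(* The limit only satisfies the weak bound [e / 3] on its distance to [h]; the radius [2 * e / 3]
   makes it strict. *)
rewrite (_ : e = 2 * e / 3 + e / 3); last by field.
apply: ball_triangle hf; rewrite -ball_normE/=.
apply: (@le_lt_trans _ _ (e / 3)); last by rewrite ltr_pM2r ?invr_gt0//; lra.
rewrite -ler_sqr ?nnegrE// ?(ltW e30)// rkhs_normE.
exact: sqnorm_le.
Qed.

HB.instance Definition _ := Uniform_isComplete.Build (rkhs K) rkhs_complete.

(* HB only builds the join [hilbertType] if this mixin comes last. *)
HB.instance Definition _ := NormedModule_hasInner.Build R (rkhs K)
  rkhs_inner_norm.

Definition feature (u : seq (R * T)) : rkhs K :=
  exist (fun f => f \in rkhs_pred K) (ksection K u)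
    (asboolT (ksection_bounded K u)).

(** The inner product is a polarization, so isometry on [u + v] and [u - v] suffices. *)
Lemma inner_feature (u v : seq (R * T)) :
  @inner R (rkhs K) (feature u) (feature v) = gram K u v.
Proof.
have K2 : nrm2 (feature u + feature v) = gram K (u ++ v) (u ++ v).
  rewrite -sqnorm_ksection /nrm2; congr sqnorm.
  by apply/funext => x; rewrite /= /ksection lin_cat.
have K3 : nrm2 (feature u - feature v) =
    gram K (u ++ comb_scale (-1) v) (u ++ comb_scale (-1) v).
  rewrite -sqnorm_ksection /nrm2; congr sqnorm.
  by apply/funext => x; rewrite /= /ksection lin_cat lin_scale mulN1r.
rewrite /inner/= /rkhs_inner /polar K2 K3 !simpg (gramC v u (psd_sym K)).
by field.
Qed.

End Rkhs.


Lemma psd_kernel_inner (R : realType) (T : Type) (K : psd_kernel R T) :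
  exists (H : hilbertType R) (phi : T -> H),
    forall x y, inner (phi x) (phi y) = K x y.
Proof.
exists (rkhs K), (fun x => feature K [:: (1, x)]) => x y.
by rewrite inner_feature gram_delta.
Qed.

(** * Operations on positive semidefinite kernels *)

Section KernelAlgebra.
Context {R : realType} {T : Type}.
Implicit Types (k : T -> T -> R) (g : T -> R) (u v : seq (R * T)).

Lemma gramD k1 k2 u v :
  gram (fun x y => k1 x y + k2 x y) u v = gram k1 u v + gram k2 u v.
Proof.
by rewrite /gram -big_split/=; apply: eq_bigr => p _; rewrite -mulrDr -linD.
Qed.

Lemma gramZ a k u v : gram (fun x y => a * k x y) u v = a * gram k u v.
Proof.
rewrite /gram mulr_sumr; apply: eq_bigr => p _.
by rewrite mulrCA; congr (_ * _); rewrite -linZ.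
Qed.

Definition twist g v : seq (R * T) := [seq (p.1 * g p.2, p.2) | p <- v].

Lemma gram_twist g k u v :
  gram (fun x y => g x * k x y * g y) u v = gram k (twist g u) (twist g v).
Proof.
rewrite /gram /lin big_map; apply: eq_bigr => p _.
rewrite big_map /= !mulr_sumr; apply: eq_bigr => q _ /=; ring.
Qed.

Lemma gram_tensor g1 g2 u v :
  gram (fun x y => g1 x * g2 y) u v = lin g1 u * lin g2 v.
Proof.
rewrite /gram [in RHS]/lin mulr_suml; apply: eq_bigr => p _.
by rewrite -mulrA; congr (_ * _); rewrite -linZ.
Qed.

Lemma gram1 u v : gram (fun _ _ => 1) u v = lin (fun=> 1) u * lin (fun=> 1) v.
Proof. by rewrite -gram_tensor mulr1. Qed.

Lemma gram_sum (k : nat -> T -> T -> R) n u v :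
  gram (fun x y => \sum_(0 <= i < n) k i x y) u v =
  \sum_(0 <= i < n) gram (k i) u v.
Proof.
elim: n => [|n IH].
  rewrite big_nil /gram big1// => p _; rewrite /lin big1 ?mulr0// => q _.
  by rewrite big_nil mulr0.
rewrite big_nat_recr//= -IH -gramD; congr gram.
by apply/funext => x; apply/funext => y; rewrite big_nat_recr.
Qed.

Lemma gram_cvg (k : nat -> T -> T -> R) k' u v :
  (forall x y, k n x y @[n --> \oo] --> k' x y) ->
  gram (k n) u v @[n --> \oo] --> gram k' u v.
Proof.
move=> kk'; apply: cvg_big => [|p _ /=]; first exact: add_continuous.
apply: cvgMl_tmp; apply: cvg_big => [|q _ /=]; first exact: add_continuous.
exact: cvgMl_tmp.
Qed.

Lemma psd_lim (k : nat -> T -> T -> R) k' :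
  (forall n, pos_semidef (k n)) ->
  (forall x y, k n x y @[n --> \oo] --> k' x y) -> pos_semidef k'.
Proof.
move=> kp kk' v; have := @gram_cvg k k' v v kk'.
move/cvgr_to_ge; apply.
by apply: nearW => n; apply: kp.
Qed.

Lemma psd_1 : pos_semidef (fun _ _ : T => 1 : R).
Proof. by move=> v; rewrite gram1 -expr2 sqr_ge0. Qed.

Lemma psd_twist g k :
  pos_semidef k -> pos_semidef (fun x y => g x * k x y * g y).
Proof. by move=> kp v; rewrite gram_twist. Qed.

Lemma psd_CauchySchwarz k x y : (forall x y, k x y = k y x) ->
  pos_semidef k -> k x y ^+ 2 <= k x x * k y y.
Proof.
move=> kC kp.
have E a b : 0 <= a ^+ 2 * k x x + 2 * a * b * k x y + b ^+ 2 * k y y.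
  have := kp (comb_scale a [:: (1, x)] ++ comb_scale b [:: (1, y)]).
  by rewrite !simpg !gram_delta (kC y x); lra.
have x0 : 0 <= k x x by have := E 1 0; lra.
have := E 0 1; rewrite expr0n mul0r mulr0 !mul0r expr1n mul1r !add0r.
rewrite le_eqVlt => /predU1P[y0|y0].
  have := E (k x y) (- (1 + k x x)); rewrite -y0; have := sqr_ge0 (k x y); nra.
have := E (k y y) (- k x y); nra.
Qed.

(** The new form evaluates [k] on [v] minus its orthogonal projection onto [x0]. *)
Lemma psd_schur_complement k x0 : (forall x y, k x y = k y x) ->
  pos_semidef k -> 0 < k x0 x0 ->
  pos_semidef (fun x y => k x y - k x0 x * k x0 y / k x0 x0).
Proof.
move=> kC kp k0 v.
have E : gram (fun x y => k x y - k x0 x * k x0 y / k x0 x0) v v =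
    gram k v v - lin (k x0) v ^+ 2 / k x0 x0.
  transitivity (gram k v v + - (k x0 x0)^-1 *
      gram (fun x y => k x0 x * k x0 y) v v).
    rewrite -gramZ -gramD; congr gram.
    by apply/funext => x; apply/funext => y; ring.
  by rewrite gram_tensor; ring.
have := kp (v ++ comb_scale (- (lin (k x0) v / k x0 x0)) [:: (1, x0)]).
have Ek : gram k [:: (1, x0)] v = lin (k x0) v by rewrite /gram big_seq1 mul1r.
rewrite !simpg gram_delta (gramC v) // Ek E.
suff -> : gram k v v + - (lin (k x0) v / k x0 x0) * lin (k x0) v +
  (- (lin (k x0) v / k x0 x0) * lin (k x0) v + - (lin (k x0) v / k x0 x0) *
    (- (lin (k x0) v / k x0 x0) * k x0 x0)) =
  gram k v v - lin (k x0) v ^+ 2 / k x0 x0 by [].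
by field; rewrite gt_eqF.
Qed.

End KernelAlgebra.

(* Schur's product theorem: subtracting a rank one kernel from k1 makes one more
   point degenerate, and on rank one kernels the product is a twist of k2. *)
Lemma psd_mul (R : realType) (T : eqType) (k1 k2 : T -> T -> R) :
  (forall x y, k1 x y = k1 y x) -> pos_semidef k1 -> pos_semidef k2 ->
  pos_semidef (fun x y => k1 x y * k2 x y).
Proof.
move=> k1C k1p k2p v.
(* Invariant of the induction on the list of points: a point of [v] outside the list is degenerate
   for [k1]. An empty list leaves the product zero on [v]. *)
have : forall p, p \in v -> p.2 \notin map snd v -> forall y, k1 p.2 y = 0.
  by move=> p pv; rewrite map_f.
elim: (map snd v) k1 k1C k1p => [|x0 s IH] k1 k1C k1p k10.
  rewrite /gram big_seq big1// => p pv.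
  by rewrite /lin big1 ?mulr0// => q _; rewrite k10// mul0r mulr0.
have := psd_CauchySchwarz x0 _ k1C k1p => CS.
have k00 : 0 <= k1 x0 x0.
  by have := k1p [:: (1, x0)]; rewrite gram_delta.
have k10' y : k1 y x0 = 0 -> k1 x0 y = 0 by rewrite k1C.
(* If [k1 x0 x0 = 0], Cauchy-Schwarz shows that [x0] is already degenerate; otherwise the Schur
   complement [k3] makes it so and keeps earlier degenerate points. *)
move: k00; rewrite le_eqVlt => /predU1P[k00|k00].
  apply: IH => // p pv ps y; have [->|px0] := eqVneq p.2 x0.
    have := CS y; rewrite -k00 mul0r real_exprn_even_le0 ?num_real//=.
    by move/eqP.
  by apply: k10 => //; rewrite inE negb_or px0.
pose k3 x y := k1 x y - k1 x0 x * k1 x0 y / k1 x0 x0.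
have -> : gram (fun x y => k1 x y * k2 x y) v v =
    gram (fun x y => k3 x y * k2 x y) v v +
    (k1 x0 x0)^-1 * gram k2 (twist (k1 x0) v) (twist (k1 x0) v).
  rewrite -gram_twist -gramZ -gramD; congr gram.
  by apply/funext => x; apply/funext => y; rewrite /k3; ring.
rewrite addr_ge0// ?mulr_ge0 ?invr_ge0 ?(ltW k00)//.
apply: IH.
- by move=> x y; rewrite /k3 k1C; ring.
- exact: psd_schur_complement.
move=> p pv ps y; rewrite /k3; have [->|px0] := eqVneq p.2 x0.
  by rewrite mulrAC divff ?gt_eqF// mul1r subrr.
have pz : forall y, k1 p.2 y = 0 by apply: k10 => //; rewrite inE negb_or px0.
by rewrite k10' pz// !mul0r subrr.
Qed.

Lemma psd_expR (R : realType) (T : eqType) (k : T -> T -> R) :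
  (forall x y, k x y = k y x) -> pos_semidef k ->
  pos_semidef (fun x y => expR (k x y)).
Proof.
move=> kC kp.
apply: (@psd_lim _ _ (fun n x y => series (exp_coeff (k x y)) n)); last first.
  by move=> x y; apply: is_cvg_series_exp_coeff.
have kX n : pos_semidef (fun x y => k x y ^+ n).
  elim: n => [|n IH]; first exact: psd_1.
  by under eq_fun do under eq_fun do rewrite exprS; apply: psd_mul.
move=> n v; rewrite gram_sum; apply: sumr_ge0 => i _.
have -> : (fun x y => exp_coeff (k x y) i) =
    (fun x y => i`!%:R^-1 * k x y ^+ i).
  by apply/funext => x; apply/funext => y; rewrite mulrC.
by rewrite gramZ mulr_ge0// ?invr_ge0// kX.
Qed.

(** * Kernels obtained from maps into a Hilbert space *)

Section InnerKernels.
Context {R : realType} {T : Type} {H : hilbertType R} (f : T -> H).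

Lemma innerC (a b : H) : inner a b = inner b a.
Proof. by rewrite hermC expr0 mul1r. Qed.

Lemma normB_inner (a b : H) :
  `|a - b| ^+ 2 = `|a| ^+ 2 - 2 * inner a b + `|b| ^+ 2.
Proof.
rewrite -!inner_norm linearBl !linearBr/= (innerC b a); ring.
Qed.

Lemma psd_inner : pos_semidef (fun x y => inner (f x) (f y)).
Proof.
move=> v; rewrite [leRHS](_ : _ = `|\sum_(p <- v) p.1 *: f p.2| ^+ 2).
  exact: sqr_ge0.
rewrite -inner_norm linear_sumlz; apply: eq_bigr => p _.
rewrite linearZl_LR; congr (_ * _); rewrite linear_sumr; apply: eq_bigr => q _.
by rewrite linearZr_LR.
Qed.

End InnerKernels.

Lemma psd_gaussian (R : realType) (T : eqType) (H : hilbertType R) (f : T -> H)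
    (t : R) : 0 <= t ->
  pos_semidef (fun x y => expR (- t * `|f x - f y| ^+ 2)).
Proof.
move=> t0.
have -> : (fun x y => expR (- t * `|f x - f y| ^+ 2)) = (fun x y =>
    expR (- t * `|f x| ^+ 2) * expR (2 * t * inner (f x) (f y)) *
    expR (- t * `|f y| ^+ 2)).
  apply/funext => x; apply/funext => y; rewrite -!expRD normB_inner.
  by congr expR; ring.
apply: psd_twist; apply: psd_expR => [x y|v]; first by rewrite innerC.
by rewrite gramZ mulr_ge0 ?mulr_ge0// psd_inner.
Qed.

(** * Kernel types through formal combinations, and decay at infinity *)

Section Types.
Context {R : realType} {X : metricType R}.
Implicit Types (k : X -> X -> R).

Lemma gram_tnth k (v : seq (R * X)) : gram k v v =
  \sum_(i < size v) \sum_(j < size v) (tnth (in_tuple v) i).1 *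
    (tnth (in_tuple v) j).1 * k (tnth (in_tuple v) i).2 (tnth (in_tuple v) j).2.
Proof.
rewrite /gram big_tnth; apply: eq_bigr => i _.
by rewrite /lin big_tnth mulr_sumr; apply: eq_bigr => j _; rewrite mulrA.
Qed.

Lemma gram_enum k n (x : 'I_n -> X) (lambda : 'I_n -> R) :
  \sum_(i < n) \sum_(j < n) lambda i * lambda j * k (x i) (x j) =
  gram k [seq (lambda i, x i) | i <- enum 'I_n]
         [seq (lambda i, x i) | i <- enum 'I_n].
Proof.
rewrite /gram big_map big_enum/=; apply: eq_bigr => i _.
rewrite /lin big_map big_enum mulr_sumr/=; apply: eq_bigr => j _.
by rewrite mulrA.
Qed.

Lemma positive_typeP k : positive_type k <-> pos_semidef k.
Proof.
split=> [kp v|kp n x lambda]; first by rewrite gram_tnth; apply: kp.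
by rewrite gram_enum; apply: kp.
Qed.

Lemma negative_typeP k : negative_type k <->
  forall v, lin (fun=> 1) v = 0 -> gram k v v <= 0.
Proof.
split=> [kn v|kn n x lambda l0].
  rewrite gram_tnth /lin big_tnth => v0; apply: kn.
  by rewrite -[RHS]v0; apply: eq_bigr => i _; rewrite mulr1.
rewrite gram_enum; apply: kn; rewrite /lin big_map big_enum/= -[RHS]l0.
by apply: eq_bigr => i _; rewrite mulr1.
Qed.

Lemma vanishes_at_infinityP k : vanishes_at_infinity k <->
  forall e : R, 0 < e ->
  exists S : R, forall x y, S <= mdist x y -> `|k x y| <= e.
Proof.
split=> [/fine_cvgP[kfin /cvgrPdist_le kc] e e0|kP].
  have : \forall s \near +oo, tail_sup k s \is a fin_num /\
      `|0 - fine (tail_sup k s)| <= e.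
    by near=> s; split; near: s => //; apply: kc.
  (* The eventual property holds strictly beyond [S], hence the shift by 1. *)
  case=> S [_ /(_ (S + 1))]; rewrite ltrDl => /(_ ltr01)[Sfin Se].
  exists (S + 1) => x y Sxy; rewrite -lee_fin.
  have : (`|k x y|%:E <= tail_sup k (S + 1))%E.
    by apply: ereal_sup_ubound; right; exists x, y.
  move=> /le_trans; apply; rewrite -(fineK Sfin) lee_fin.
  by move: Se; rewrite sub0r normrN; apply: le_trans; apply: ler_norm.
have tail_le (e : R) : 0 < e ->
    \forall s \near +oo, (0 <= tail_sup k s <= e%:E)%E.
  move=> e0; have [S kS] := kP e e0; near=> s; apply/andP; split.
    by apply: ereal_sup_ubound; left.
  apply: ge_ereal_sup => _ [->|[x [y [sxy ->]]]]; rewrite lee_fin.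
    exact: ltW.
  apply: kS; apply: le_trans sxy; near: s.
  by apply: nbhs_pinfty_ge; rewrite num_real.
apply/fine_cvgP; split.
  apply: filterS (tail_le 1 ltr01) => s /andP[s0 s1].
  by rewrite ge0_fin_numE// (le_lt_trans s1)// ltry.
apply/cvgrPdist_le => e e0; apply: filterS (tail_le e e0) => s /andP[s0 s1] /=.
have sfin : tail_sup k s \is a fin_num.
  by rewrite ge0_fin_numE// (le_lt_trans s1)// ltry.
rewrite sub0r normrN ger0_norm ?fine_ge0//.
by rewrite -lee_fin fineK.
Unshelve. all: end_near. Qed.

End Types.

(** * Coarse embeddings *)

Section Implications.
Context {R : realType} {X : metricType R}.

Lemma coarse_embedding_unit_vectors :
  coarsely_embeddable_in_Hilbert X -> forall r e : R, 0 < r -> 0 < e ->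
  exists (H : hilbertType R) (eta : X -> H),
    [/\ forall x, `|eta x| = 1, has_variation r e eta &
        vanishes_at_infinity (fun x y => inner (eta x) (eta y))].
Proof.
move=> [H [f [fprop fborn]]] r e r0 e0.
(* Variation concerns distances [<= r], bornology strict bounds; [r + 1] bridges them. With
   [t * s ^+ 2 = e ^+ 2 / 4], the squared distance [2 - 2 k] of the unit vectors stays below
   [e ^+ 2 / 2]. *)
have [s s0 fs] := fborn (r + 1) (ltr_wpDl (ltW r0) ltr01).
pose t := e ^+ 2 / (4 * s ^+ 2).
have t0 : 0 < t by rewrite divr_gt0 ?mulr_gt0 ?exprn_gt0.
pose k x y := expR (- t * `|f x - f y| ^+ 2).
have kC x y : k x y = k y x by rewrite /k distrC.
have [H' [eta etaE]] :=
  psd_kernel_inner (PsdKernel kC (psd_gaussian f (ltW t0))).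
rewrite /= in etaE.
have eta1 x : `|eta x| = 1.
  apply/eqP; rewrite -sqrp_eq1// -inner_norm etaE /k.
  by rewrite subrr normr0 expr0n mulr0 expR0.
exists H', eta; split=> // [x y xy|].
  have {}xy : `|f x - f y| < s.
    by rewrite -mdist_hilbertE; apply: fs; rewrite (le_lt_trans xy)//
      ltrDl ltr01.
  rewrite -(ltr_pXn2r (_ : 0 < 2)%N)// ?nnegrE ?(ltW e0)// normB_inner.
  rewrite !eta1 etaE.
  have : 1 - t * `|f x - f y| ^+ 2 <= k x y by rewrite -mulNr expR_ge1Dx.
  have : t * `|f x - f y| ^+ 2 < e ^+ 2 / 4.
    rewrite (_ : e ^+ 2 / 4 = t * s ^+ 2); last first.
      by rewrite /t; field; rewrite gt_eqF.
    by rewrite ltr_pM2l// ltr_pXn2r// nnegrE ?normr_ge0 ?(ltW s0).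
  have : 0 < e ^+ 2 by rewrite exprn_gt0.
  lra.
apply/vanishes_at_infinityP => d d0.
(* Beyond distance [M] in [H] the exponent is at most [- 1 / d], and [exp (- 1 / d) <= d] follows
   from [exp z >= 1 + z]. *)
pose M := Num.sqrt (1 / (t * d)).
have M0 : 0 < M by rewrite sqrtr_gt0 divr_gt0// mulr_gt0.
have [S S0 fS] := fprop M M0; exists S => x y Sxy.
rewrite etaE ger0_norm ?expR_ge0//.
have {}Sxy : M <= `|f x - f y|.
  rewrite -mdist_hilbertE leNgt; apply/negP => xy.
  by have := fS x y; rewrite /= !ballEmdist/= => /(_ xy); rewrite ltNge Sxy.
have : (t * d)^-1 <= `|f x - f y| ^+ 2.
  rewrite -[leLHS]sqr_sqrtr; last by rewrite invr_ge0 mulr_ge0// ltW.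
  by rewrite ler_sqr ?nnegrE ?sqrtr_ge0// -[_^-1]mul1r.
rewrite invfM ler_pdivrMl// => td.
rewrite /k mulNr expRN -[d]invrK lef_pV2 ?posrE ?expR_gt0 ?invr_gt0//.
apply: le_trans td _; apply: le_trans (expR_ge1Dx _).
by rewrite lerDr.
Qed.

Lemma unit_vectors_kernel :
  (forall r e : R, 0 < r -> 0 < e ->
   exists (H : hilbertType R) (eta : X -> H),
    [/\ forall x, `|eta x| = 1, has_variation r e eta &
        vanishes_at_infinity (fun x y => inner (eta x) (eta y))]) ->
  forall r e : R, 0 < r -> 0 < e -> exists k : X -> X -> R,
    [/\ symmetric_kernel k, normalised_positive_type k,
        kernel_has_variation r e k & vanishes_at_infinity k].
Proof.
move=> HP r e r0 e0.
(* For unit vectors at distance [d], the kernel differs from 1 by [d ^+ 2 / 2], which is below [e]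
   once [d < 1] and [d < e]. *)
have e10 : 0 < Num.min 1 e by rewrite lt_min ltr01.
have [H [eta [eta1 etavar etainf]]] := HP r _ r0 e10.
exists (fun x y => inner (eta x) (eta y)); split=> // [x y||x y xy].
- exact: innerC.
- split; first exact/positive_typeP/psd_inner.
  by move=> x; rewrite inner_norm eta1 expr1n.
have := etavar x y xy; rewrite lt_min => /andP[d1 de].
have := normB_inner (eta x) (eta y); rewrite !eta1.
have := normr_ge0 (eta x - eta y); set d := `|_| in d1 de *.
by move=> d0 dE; rewrite ltr_norml; apply/andP; split; nra.
Qed.

Lemma indicator_sum_le (d : R) n : 0 <= d ->
  \sum_(0 <= i < n) (i%:R < d)%R%:R <= d + 1.
Proof.
move=> d0.
(* The extra bound by [n] feeds the induction: a new term counts only when [n < d], and then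
   [n + 1 < d + 1]. *)
suff : \sum_(0 <= i < n) (i%:R < d)%R%:R <= Num.min (d + 1) n%:R.
  by rewrite le_min => /andP[].
elim: n => [|n]; first by rewrite big_nil le_min lexx andbT addr_ge0.
rewrite big_nat_recr//= !le_min -natr1 => /andP[h1 h2].
case: ltP => nd /=; lra.
Qed.

Lemma geometric_sum_le n : \sum_(0 <= i < n) (2^-1 : R) ^+ i <= 2.
Proof.
suff -> : \sum_(0 <= i < n) (2^-1 : R) ^+ i = 2 - 2 * 2^-1 ^+ n.
  by rewrite gerBl mulr_ge0// exprn_ge0// invr_ge0.
elim: n => [|n IH]; first by rewrite big_nil expr0; lra.
by rewrite big_nat_recr//= IH exprS; lra.
Qed.

Lemma kernel_negative_type :
  (forall r e : R, 0 < r -> 0 < e -> exists k : X -> X -> R,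
    [/\ symmetric_kernel k, normalised_positive_type k,
        kernel_has_variation r e k & vanishes_at_infinity k]) ->
  exists (k : X -> X -> R) (rho1 rho2 : R -> R),
    [/\ symmetric_kernel k /\ normalised_negative_type k,
        nondecreasing_nonneg_map rho1, nondecreasing_nonneg_map rho2,
        rho1 t @[t --> +oo] --> +oo &
        forall x y, rho1 (mdist x y) <= k x y <= rho2 (mdist x y)].
Proof.
move=> kP.
have /choice[k_ k_P] : forall n : nat, exists k : X -> X -> R,
    [/\ symmetric_kernel k, normalised_positive_type k,
        (* The radius [n + 1] is positive even at [n = 0]. *)
        kernel_has_variation n.+1%:R ((2^-1) ^+ n) k & vanishes_at_infinity k].
  by move=> n; apply: kP; rewrite ?exprn_gt0// invr_gt0.
have kC n : symmetric_kernel (k_ n) by have [] := k_P n.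
have kpos n : pos_semidef (k_ n).
  by have [_ [/positive_typeP]] := k_P n.
have k1 n x : k_ n x x = 1 by have [_ []] := k_P n.
have kvar n x y : mdist x y <= n.+1%:R -> `|k_ n x y - 1| < (2^-1) ^+ n.
  by have [_ _ + _] := k_P n; apply.
have /choice[S SP] : forall n, exists S : R, forall x y,
    S <= mdist x y -> `|k_ n x y| <= 2^-1.
  move=> n; have [_ _ _ /vanishes_at_infinityP] := k_P n; apply.
  by rewrite invr_gt0.
have kle1 n x y : k_ n x y <= 1 /\ -1 <= k_ n x y.
  have := psd_CauchySchwarz x y (kC n) (kpos n); rewrite !k1; nra.
pose u x y n := 1 - k_ n x y.
have u0 x y n : 0 <= u x y n by rewrite subr_ge0; case: (kle1 n x y).
have u_le x y n : u x y n <= 2 * (n%:R < mdist x y)%R%:R + (2^-1) ^+ n.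
  have e0 : 0 < (2^-1 : R) ^+ n by rewrite exprn_gt0// invr_gt0.
  have [nd|dn] /= := ltP; first by case: (kle1 n x y) => _; rewrite /u; lra.
  have : `|k_ n x y - 1| < (2^-1) ^+ n.
    by apply: kvar; rewrite (le_trans dn)// ler_nat.
  by rewrite ltr_norml /u => /andP[]; lra.
have su_le x y n : series (u x y) n <= 2 * (mdist x y + 1) + 2.
  have : series (u x y) n <=
      \sum_(0 <= i < n) (2 * (i%:R < mdist x y)%R%:R + (2^-1) ^+ i).
    exact: ler_sum.
  rewrite big_split/= -mulr_sumr.
  have := indicator_sum_le n (mdist_ge0 x y); have := geometric_sum_le n; lra.
have su_nd x y : nondecreasing_seq (series (u x y)).
  exact: nondecreasing_series.
have su_cvg x y : cvgn (series (u x y)).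
  apply: nondecreasing_is_cvgn => //.
  by exists (2 * (mdist x y + 1) + 2) => _ [n _ <-].
pose k x y := limn (series (u x y)).
(* Half the number of indices below [t] whose decay threshold [S i] has been passed; cutting at
   [Num.truncn t] keeps the sum finite. *)
pose rho1 (t : R) : R := \sum_(0 <= i < Num.truncn t) (S i <= t)%R%:R / 2.
exists k, rho1, (fun t => 2 * (t + 1) + 2); split.
- split=> [x y|].
    by rewrite /k; congr (limn (series _)); apply/funext => n; rewrite /u kC.
  split=> [|x]; last first.
    rewrite /k (_ : series _ = cst 0) ?lim_cst//.
    by apply/funext => n; rewrite /series/= big1// => i _; rewrite /u k1 subrr.
  apply/negative_typeP => v v0.
  have := @gram_cvg _ _ (fun n x y => series (u x y) n) k v v su_cvg.
  move/cvgr_to_le; apply.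
  apply: nearW => n; rewrite gram_sum; apply: sumr_le0 => i _.
  (* On combinations of total weight 0 the constant kernel contributes nothing, which leaves minus a
     positive form. *)
  have -> : gram (fun x y => u x y i) v v =
      gram (fun _ _ => 1) v v + -1 * gram (k_ i) v v.
    rewrite -gramZ -gramD; congr gram; apply/funext => x; apply/funext => y.
    by rewrite mulN1r.
  by rewrite gram1 v0 mul0r add0r mulN1r oppr_le0 kpos.
- split=> [t _|s t s0 t0 st]; first by apply: sumr_ge0 => i _; apply: divr_ge0.
  have sn : (Num.truncn s <= Num.truncn t)%N by apply: le_truncn.
  rewrite /rho1 (big_cat_nat (leq0n _) sn)/=.
  apply: (@le_trans _ _ (\sum_(0 <= i < Num.truncn s) (S i <= t)%R%:R / 2)).
    apply: ler_sum => i _; rewrite ler_pM2r ?invr_gt0// ler_nat.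
    by case: leP => // Ss; rewrite (le_trans Ss st).
  by rewrite lerDl; apply: sumr_ge0 => i _; apply: divr_ge0.
- split=> [t|s t _ _ st]; first by rewrite nnegrE; lra.
  by lra.
- apply/cvgryPge => A.
  (* The first [n] terms, each worth one half, add up to more than [|A|]; [B] dominates [n] and
     their thresholds, so all of them are present from [B] on. *)
  pose n := (Num.truncn (2 * `|A|)).+1.
  pose B := n%:R + \sum_(0 <= i < n) `|S i|.
  have Bn : n%:R <= B by rewrite lerDl; apply: sumr_ge0.
  near=> t.
  have Bt : B <= t by near: t; apply: nbhs_pinfty_ge; rewrite num_real.
  have nt : (n <= Num.truncn t)%N.
    by rewrite truncn_ge_nat ?(le_trans Bn)// (le_trans _ Bt).
  rewrite /rho1 (big_cat_nat (leq0n _) nt)/=.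
  apply: (@le_trans _ _ (\sum_(0 <= i < n) 2^-1)).
    rewrite sumr_const_nat subn0 -[leRHS]mulr_natl ler_pdivlMr//.
    have := truncnS_gt (2 * `|A|); rewrite -/n; have := ler_norm A; lra.
  apply: le_trans (_ : _ <= \sum_(0 <= i < n) (S i <= t)%R%:R / 2) _;
    last first.
    by rewrite lerDl; apply: sumr_ge0 => i _; apply: divr_ge0.
  rewrite big_nat [leRHS]big_nat; apply: ler_sum => i /andP[_ i_n].
  suff -> : S i <= t by rewrite mul1r.
  apply: le_trans Bt; apply: (@le_trans _ _ `|S i|); first exact: ler_norm.
  rewrite /B (bigD1_seq i) ?mem_index_iota ?iota_uniq//.
  by rewrite addrCA lerDl addr_ge0// sumr_ge0.
move=> x y; apply/andP; split; last first.
  by apply: limr_le => //; apply: nearW.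
(* The limit dominates the partial sum with the same index range as [rho1], and the two sums compare
   term by term. *)
apply: le_trans (nondecreasing_cvgn_le (su_nd x y) (su_cvg x y)
  (Num.truncn (mdist x y))).
apply: ler_sum => i _; case: (leP (S i)) => /= [Sd|_]; last by rewrite mul0r.
rewrite mul1r /u; have := SP i x y Sd; rewrite ler_norml => /andP[_].
lra.
Unshelve. all: end_near. Qed.

Lemma negative_type_inner (k : X -> X -> R) :
  symmetric_kernel k -> normalised_negative_type k ->
  exists (H : hilbertType R) (f : X -> H),
    forall x y, `|f x - f y| ^+ 2 = k x y.
Proof.
move=> kC [/negative_typeP kn k0].
(* An empty [X] has no base point; the zero kernel then supplies some Hilbert space. *)
have [[x0]|noX] := pselect (inhabited X); last first.
  have C0 (x y : X) : 0 = 0 :> R by [].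
  have p0 : pos_semidef (fun _ _ : X => 0 : R).
    by move=> v; rewrite /gram big1// => p _; case: noX; split; exact: p.2.
  have [H [f _]] := psd_kernel_inner (PsdKernel C0 p0).
  by exists H, f => x; case: noX; split.
pose h x y := (k x x0 + k y x0 - k x y) / 2.
have hC x y : h x y = h y x by rewrite /h (kC x y) (addrC (k x x0)).
have hp : pos_semidef h.
  move=> v; pose l := lin (fun=> 1) v.
  (* Adding [x0] with weight [- l] balances [v]; on the balanced combination [k] takes the value
     [- 2 * gram h v v]. *)
  have : lin (fun=> 1) (v ++ comb_scale (- l) [:: (1, x0)]) = 0.
    by rewrite lin_cat lin_scale lin_delta mulr1 subrr.
  move=> /kn; rewrite !simpg gram_delta k0 (gramC [:: _] v kC).
  pose L := lin (k^~ x0) v.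
  have -> : gram k v [:: (1, x0)] = L.
    by rewrite gramEr lin_delta.
  have -> : gram h v v = L * l - 2^-1 * gram k v v.
    have -> : h = (fun x y =>
        2^-1 * (k x x0 * 1 + 1 * k y x0 + -1 * k x y)).
      by apply/funext => x; apply/funext => y; rewrite /h; ring.
    rewrite gramZ 2!gramD (gramZ (-1)).
    rewrite (gram_tensor (k^~ x0) (fun=> 1)) (gram_tensor (fun=> 1) (k^~ x0)).
    by rewrite -/l -/L; field.
  lra.
have [H [f fE]] := psd_kernel_inner (PsdKernel hC hp).
exists H, f => x y; rewrite normB_inner -!inner_norm !fE /= /h !k0.
lra.
Qed.

Lemma negative_type_coarse_embedding :
  (exists (k : X -> X -> R) (rho1 rho2 : R -> R),
    [/\ symmetric_kernel k /\ normalised_negative_type k,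
        nondecreasing_nonneg_map rho1, nondecreasing_nonneg_map rho2,
        rho1 t @[t --> +oo] --> +oo &
        forall x y, rho1 (mdist x y) <= k x y <= rho2 (mdist x y)]) ->
  coarsely_embeddable_in_Hilbert X.
Proof.
move=> [k [rho1 [rho2 [[kC kn] [_ r1] [r20 r2] /cvgryPge r1y kr]]]].
have [H [f fE]] := negative_type_inner kC kn.
exists H, f; split=> r r0.
  have [S [_ SP]] := r1y (r ^+ 2).
  (* Strictly beyond [S], so that [rho1 s >= r ^+ 2], and positive, since [rho1] is monotone only on
     nonnegative reals. *)
  pose s := Num.max 0 S + 1.
  have s0 : 0 < s by rewrite ltr_wpDl// le_max lexx.
  have Ss : S < s by rewrite ltr_pwDr// le_max lexx orbT.
  exists s => // x y; rewrite /= !ballEmdist/= mdist_hilbertE => fxy.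
  rewrite ltNge; apply/negP => sxy.
  have := kr x y => /andP[k1 _].
  have := r1 s (mdist x y); rewrite !nnegrE (ltW s0) mdist_ge0.
  move=> /(_ isT isT sxy).
  have := SP s Ss.
  have : `|f x - f y| ^+ 2 < r ^+ 2.
    by rewrite ltr_pXn2r// nnegrE ?normr_ge0 ?(ltW r0).
  rewrite fE; lra.
(* The added 1 makes both the positivity and the final inequality strict. *)
exists (Num.sqrt (rho2 r) + 1) => [|x y xy].
  by rewrite ltr_wpDl// sqrtr_ge0.
rewrite mdist_hilbertE; apply: (@le_lt_trans _ _ (Num.sqrt (rho2 r))).
  rewrite -[leLHS]ger0_norm// -sqrtr_sqr ler_wsqrtr// fE.
  have := kr x y => /andP[_ /le_trans]; apply.
  by apply: r2; rewrite ?nnegrE ?mdist_ge0// ltW.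
by rewrite ltrDl.
Qed.

End Implications.

Theorem theorem3p2p8 (R : realType) (X : metricType R) :
  [<-> coarsely_embeddable_in_Hilbert X ;

       forall r e : R, 0 < r -> 0 < e ->
         exists (H : hilbertType R) (eta : X -> H),
           [/\ forall x, `|eta x| = 1,
               has_variation r e eta &
               vanishes_at_infinity (fun x y => inner (eta x) (eta y))] ;

       forall r e : R, 0 < r -> 0 < e ->
         exists k : X -> X -> R,
           [/\ symmetric_kernel k, normalised_positive_type k,
               kernel_has_variation r e k & vanishes_at_infinity k] ;

       exists (k : X -> X -> R) (rho1 rho2 : R -> R),
         [/\ symmetric_kernel k /\ normalised_negative_type k,
             nondecreasing_nonneg_map rho1,
             nondecreasing_nonneg_map rho2,
             rho1 t @[t --> +oo] --> +oo &
             forall x y, rho1 (mdist x y) <= k x y <= rho2 (mdist x y)] ].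
Proof.
tfae.
- exact: coarse_embedding_unit_vectors.
- exact: unit_vectors_kernel.
- exact: kernel_negative_type.
- exact: negative_type_coarse_embedding.
Qed.
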